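(* Let $\beta\in(0,1)$ and $n\in\mathbb{N}$. Let $\rho_{n+1}$ be the state occupancy density of the policy at epoch $n+1$, let $\mu_n$ be the discounted mixture of past state occupancies up to epoch $n$, and let $\mu_{n+1}=\beta\rho_{n+1}+(1-\beta)\mu_n$. Write $H_k=H_{\mu_k}[S]$ for the Shannon entropy of $\mu_k$, and let $\Delta_{n+1}=H_{n+1}-H_n$. Assume that the entropies $H_n$, $H_{n+1}$, $H_{\rho_{n+1}}[S]$ are well defined and finite. Then $$\Delta_{n+1}\;\geq\;\beta\left(\mathrm{D}_{\mathrm{KL}}(\rho_{n+1}\,\|\,\mu_{n+1})+H_{\rho_{n+1}}[S]-H_n\right).$$
   Context: $(\mathcal{S},\mathcal{A},P,\delta_0)$ is a reward-free Markov decision process with state space $\mathcal{S}$, action space $\mathcal{A}$, transition kernel $P$ and initial state distribution $\delta_0$. Densities on $\mathcal{S}$ are taken with respect to a fixed reference measure, written $\mathrm{d}s$ (e.g. counting measure if $\mathcal{S}$ is discrete, Lebesgue measure if continuous). For a policy $\pi$ (a map from states to distributions over actions) and a fixed horizon $T\geq 1$, the state occupancy density is the probability density $$\rho^{\pi}(s)=\mathbb{E}\left[\frac1T\sum_{t=1}^{T}\mathbb{1}_s(s_t)\right],\quad s_1\sim\delta_0,\ a_t\sim\pi(\cdot|s_t),\ s_{t+1}\sim P(\cdot|s_t,a_t),$$ i.e. the density of the average over $t=1,\dots,T$ of the laws of $s_t$. Given a sequence of policies $\pi_1,\pi_2,\dots$ (one per epoch), $\rho_k=\rho^{\pi_k}$.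 The mixtures of past occupancies $\mu_n$ are probability densities on $\mathcal{S}$ defined recursively from an initial probability density $\mu_0$ by $\mu_{k+1}=\beta\rho_{k+1}+(1-\beta)\mu_k$. For a probability density $\nu$, $H_\nu[S]=-\int_{\mathcal{S}}\nu(s)\log\nu(s)\,\mathrm{d}s$; for probability densities $\nu,\mu$, $\mathrm{D}_{\mathrm{KL}}(\nu\|\mu)=\int_{\mathcal{S}}\nu(s)\log\frac{\nu(s)}{\mu(s)}\,\mathrm{d}s$, with $0\log 0=0$. *)

(* Defs.v *)
From HB Require Import structures.
From mathcomp Require Import all_boot all_order all_algebra.
From mathcomp Require Import all_classical all_reals all_analysis.

Set Implicit Arguments.
Unset Strict Implicit.
Unset Printing Implicit Defensive.

Import Order.TTheory GRing.Theory Num.Theory.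
Import numFieldNormedType.Exports.

Local Open Scope classical_set_scope.
Local Open Scope ring_scope.
Local Open Scope ereal_scope.

Section state_occupancy.
Context (dS dA : measure_display) (S : measurableType dS)
  (A : measurableType dA) (R : realType).
Variables (P : R.-pker (S * A) ~> S) (pi : R.-pker S ~> A).

(* Law of s' when s ~ mu, a ~ pi(.|s), s' ~ P(.|s,a). *)
Definition next_law (mu : probability S R) (B : set S) : \bar R :=
  \int[mu]_s \int[pi s]_a P (s, a) B.

Section next_law_probability.
Variable mu : probability S R.

Let next_law0 : next_law mu set0 = 0.
Proof.
rewrite /next_law integral0_eq// => s _.
by rewrite integral0_eq// => a _; rewrite measure0.
Qed.

Let next_law_ge0 B : 0 <= next_law mu B.
Proof. by apply: integral_ge0 => s _; exact: integral_ge0. Qed.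

Let next_law_sigma_additive : semi_sigma_additive (next_law mu).
Proof.
move=> U mU tU mUU.
rewrite [X in _ --> X](_ : _ = \int[mu]_s (\sum_(n <oo) (pi \; P) s (U n))).
  apply/cvg_closeP; split.
    by apply: is_cvg_nneseries => n _ _; exact: next_law_ge0.
  rewrite closeE// integral_nneseries// => n.
  exact: (measurable_kernel (pi \; P) _ (mU n)).
apply: eq_integral => s _.
by apply/esym/cvg_lim => //; exact: (measure_semi_sigma_additive (s := (pi \; P) s)).
Qed.

HB.instance Definition _ := isMeasure.Build _ _ _ (next_law mu)
  next_law0 next_law_ge0 next_law_sigma_additive.

Let next_law_setT : next_law mu setT = 1.
Proof.
rewrite /next_law (eq_integral (cst 1)) => [|s _]; last first.
  rewrite (eq_integral (cst 1)) => [|a _]; last by rewrite prob_kernel.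
  by rewrite integral_cst// mul1e prob_kernel.
rewrite integral_cst// mul1e. exact: probability_setT.
Qed.

HB.instance Definition _ :=
  Measure_isProbability.Build _ _ _ (next_law mu) next_law_setT.

End next_law_probability.

(* Time is shifted by one: [state_law d0 t] is the law of s_{t+1}. *)
Fixpoint state_law (d0 : probability S R) (t : nat) : probability S R :=
  if t is t'.+1 then next_law (state_law d0 t') else d0.

Definition occupancy (d0 : probability S R) (T : nat) (B : set S) : \bar R :=
  (T%:R^-1)%:E * \sum_(t < T) state_law d0 t B.

End state_occupancy.

Section densities.
Context (d : measure_display) (S : measurableType d) (R : realType).
Variable nu : {measure set S -> \bar R}.

Definition is_prob_density (f : S -> R) : Prop :=
  [/\ measurable_fun setT f, forall s, (0 <= f s)%R
    & \int[nu]_s (f s)%:E = 1].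

Definition is_density_of (m : set S -> \bar R) (f : S -> R) : Prop :=
  forall B, measurable B -> m B = \int[nu]_(s in B) (f s)%:E.

(* No case split at [f s = 0]: 0 * ln 0 = 0. *)
Definition entropy_integrand (f : S -> R) (s : S) : \bar R :=
  (f s * ln (f s))%:E.

Definition entropy (f : S -> R) : \bar R :=
  - \int[nu]_s entropy_integrand f s.

Definition finite_entropy (f : S -> R) : Prop :=
  nu.-integrable setT (entropy_integrand f).

(* p log (p / q) with 0 log (0 / q) = 0, and p log (p / 0) = +oo when p > 0;
   the latter needs an explicit case since p / 0 = 0 in R. *)
Definition KL_integrand (p q : S -> R) (s : S) : \bar R :=
  if p s == 0%R then 0
  else if q s == 0%R then +oo
  else (p s * ln (p s / q s))%:E.

Definition KL (p q : S -> R) : \bar R := \int[nu]_s KL_integrand p q s.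

End densities.

Fixpoint mixture (S : Type) (R : realType) (beta : R) (rho : nat -> S -> R)
    (mu0 : S -> R) (n : nat) : S -> R :=
  if n is k.+1 then
    fun s => (beta * rho k.+1 s + (1 - beta) * mixture beta rho mu0 k s)%R
  else mu0.

(* Main.v *)
Require Import Defs.
From mathcomp Require Import all_boot all_order all_algebra.
From mathcomp Require Import all_classical all_reals all_analysis.
From mathcomp Require Import ring lra.
From mathcomp Require Import measurable_realfun.

Import Order.TTheory GRing.Theory Num.Theory.
Import numFieldNormedType.Exports.

Local Open Scope classical_set_scope.
Local Open Scope ring_scope.
Local Open Scope ereal_scope.

(** Write q = beta r + (1 - beta) m. Splitting q ln q linearly and inserting
    r ln r and m ln m gives
      H(q) = beta (KL(r || q) + H(r)) + (1 - beta) (KL(m || q) + H(m)),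
    and KL(m || q) >= 0 by Gibbs' inequality. The pointwise form
    x ln x - x ln y >= x - y of Gibbs' inequality also shows that KL(r || q) is
    finite, since q >= beta r bounds r ln (r / q) above by - r ln beta. *)

(** This is [ln u <= u - 1] at [u = y / x], multiplied by [x]. At [x = 0] the left side is [- y] and
    the right side vanishes. *)
Lemma gibbs_pointwise (R : realType) (x y : R) :
  (0 <= x -> 0 <= y -> (0 < x -> 0 < y) ->
   x - y <= x * ln x - x * ln y)%R.
Proof.
move=> x0 y0 xy; have [->|xn0] := eqVneq x 0%R.
  by rewrite !mul0r subr0 sub0r oppr_le0.
have xgt0 : (0 < x)%R by rewrite lt_def xn0.
have ygt0 := xy xgt0.
have := @le_ln1Dx R (y / x - 1)%R.
rewrite ltrBrDl subrr divr_gt0// => /(_ isT).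
rewrite addrC subrK ln_div ?posrE// -(ler_pM2l xgt0).
have -> : (x * (y / x - 1) = y - x)%R by field.
lra.
Qed.

(** Monotonicity of [ln] gives [ln c + ln x <= ln y], which is then multiplied by [x]. *)
Lemma xlnx_sub_xlny_le (R : realType) (c x y : R) :
  (0 < c -> 0 <= x -> c * x <= y ->
   x * ln x - x * ln y <= - ln c * x)%R.
Proof.
move=> c0 x0 cxy; have [->|xn0] := eqVneq x 0%R.
  by rewrite !(mul0r, mulr0) subrr.
have xgt0 : (0 < x)%R by rewrite lt_def xn0.
have cx0 : (0 < c * x)%R by rewrite mulr_gt0.
have : (ln (c * x) <= ln y)%R.
  by rewrite ler_ln ?posrE// (lt_le_trans cx0).
rewrite lnM ?posrE// -(ler_pM2l xgt0); lra.
Qed.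

Section dominated_densities.
Context (d : measure_display) (S : measurableType d) (R : realType).
Variable nu : {measure set S -> \bar R}.

Lemma prob_density_integrable (f : S -> R) :
  is_prob_density nu f -> nu.-integrable setT (EFin \o f).
Proof.
case=> mf f0 f1; apply/integrableP; split; first exact/measurable_EFinP.
under eq_integral do rewrite /= ger0_norm//.
by rewrite f1 ltry.
Qed.

Lemma prob_density_mix (b : R) (f g : S -> R) : (0 <= b <= 1)%R ->
  is_prob_density nu f -> is_prob_density nu g ->
  is_prob_density nu (fun s => b * f s + (1 - b) * g s)%R.
Proof.
move=> /andP[b0 b1] pf pg; have [mf f0 f1] := pf; have [mg g0 g1] := pg.
have b1' : (0 <= 1 - b)%R by rewrite subr_ge0.
split.
- by apply: measurable_funD; apply: measurable_funM.
- by move=> s; rewrite addr_ge0 ?mulr_ge0.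
- under eq_integral do rewrite EFinD !EFinM.
  rewrite integralD//=; try by
    [apply: integrableZl => //; exact: prob_density_integrable].
  rewrite !integralZl//; try exact: prob_density_integrable.
  by rewrite f1 g1 !mule1 -EFinD addrC subrK.
Qed.

Variables (c : R) (p q : S -> R).
Hypotheses (c_gt0 : (0 < c)%R) (cpq : forall s, (c * p s <= q s)%R).
Hypotheses (pp : is_prob_density nu p) (pq : is_prob_density nu q).

Let p_ge0 s : (0 <= p s)%R. Proof. by case: pp. Qed.
Let q_ge0 s : (0 <= q s)%R. Proof. by case: pq. Qed.

Lemma dominated_gt0 s : (0 < p s -> 0 < q s)%R.
Proof. by move=> ps; apply: lt_le_trans (cpq s); rewrite mulr_gt0. Qed.

(** The [+oo] branch is never reached, since [c * p s <= q s] makes [q s] positive wherever [p s]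
    is. Where [p s = 0], both sides vanish. *)
Lemma KL_integrand_dominated :
  KL_integrand p q = EFin \o (fun s => p s * ln (p s) - p s * ln (q s))%R.
Proof.
apply/funext => s; rewrite /KL_integrand /=.
case: eqP => [->|/eqP pn0]; first by rewrite !mul0r subrr.
have ps : (0 < p s)%R by rewrite lt_def pn0 p_ge0.
have qs := dominated_gt0 s ps.
by rewrite gt_eqF// ln_div ?posrE// mulrBr.
Qed.

Lemma KL_integrable_dominated : nu.-integrable setT (KL_integrand p q).
Proof.
have [mp _ _] := pp; have [mq _ _] := pq.
have mln (f : S -> R) : measurable_fun setT f ->
    measurable_fun setT (fun s => ln (f s)).
  by move=> mf; apply: measurableT_comp => //; exact: measurable_ln.
rewrite KL_integrand_dominated.
(* The integrand lies between [p - q] (pointwise Gibbs) and [- ln c * p] (domination), so [g] bounds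
   its absolute value. *)
pose g s := (`|ln c| * p s + (p s + q s))%R.
apply: (@le_integrable _ _ _ nu setT measurableT _ (EFin \o g)).
- apply/measurable_EFinP; apply: measurable_funB;
    by apply: measurable_funM => //; exact: mln.
- move=> s _; rewrite /= lee_fin /g.
  have ub := xlnx_sub_xlny_le _ _ _ _ c_gt0 (p_ge0 s) (cpq s).
  have lb := gibbs_pointwise _ _ _ (p_ge0 s) (q_ge0 s) (dominated_gt0 s).
  have : (- ln c * p s <= `|ln c| * p s)%R.
    by rewrite ler_wpM2r// -normrN ler_norm.
  have : (0 <= `|ln c| * p s)%R by rewrite mulr_ge0.
  move: (p_ge0 s) (q_ge0 s) => p0 q0 *.
  rewrite (@ger0_norm _ (_ + (_ + _))%R) ?ler_norml; last lra.
  by apply/andP; split; lra.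
- have ip := prob_density_integrable _ pp; have iq := prob_density_integrable _ pq.
  rewrite (_ : EFin \o g = (fun s => `|ln c|%:E * (p s)%:E) \+
      ((EFin \o p) \+ (EFin \o q))); last first.
    by apply/funext => s; rewrite /g /= !EFinD EFinM.
  by apply: integrableD => //; [exact: integrableZl|exact: integrableD].
Qed.

End dominated_densities.

Lemma entropy_mix_ge (R : realType) (d : measure_display)
    (S : measurableType d) (nu : {measure set S -> \bar R}) (b : R)
    (r m : S -> R) (q := fun s => (b * r s + (1 - b) * m s)%R) :
  (0 < b)%R -> (b < 1)%R ->
  is_prob_density nu r -> is_prob_density nu m ->
  finite_entropy nu r -> finite_entropy nu m -> finite_entropy nu q ->
  b%:E * (KL nu r q + entropy nu r - entropy nu m)
    <= entropy nu q - entropy nu m.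
Proof.
move=> b0 b1 pr pm hr hm hq.
have [_ r0 r1] := pr; have [_ m0 m1] := pm.
have pq : is_prob_density nu q.
  by apply: prob_density_mix => //; rewrite !ltW.
have [_ q0 q1] := pq.
have c0 : (0 < 1 - b)%R by rewrite subr_gt0.
(* The mixture dominates both of its components, with constants [b] for [r] and [1 - b] for [m], so
   both divergences have integrable integrands. *)
have brq s : (b * r s <= q s)%R by rewrite lerDl mulr_ge0// ltW.
have cmq s : ((1 - b) * m s <= q s)%R by rewrite lerDr mulr_ge0// ltW.
have iK := KL_integrable_dominated _ _ _ nu _ _ _ b0 brq pr pq.
have iG := KL_integrable_dominated _ _ _ nu _ _ _ c0 cmq pm pq.
have gibbs : 0 <= KL nu m q.
  have im := prob_density_integrable _ _ _ _ _ pm.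
  have iq := prob_density_integrable _ _ _ _ _ pq.
  (* Both densities have mass 1, so 0 can be written as the integral of the pointwise lower bound
     [m - q]. *)
  rewrite -[leLHS](_ : \int[nu]_s ((m s)%:E - (q s)%:E) = 0); last first.
    by rewrite integralB// m1 q1 subee.
  apply: le_integral => //; first exact: integrableB.
  move=> s _; rewrite (KL_integrand_dominated _ _ _ nu _ _ _ c0 cmq pm).
  rewrite /= -EFinB lee_fin; apply: gibbs_pointwise => //.
  exact: dominated_gt0 c0 cmq _.
have split_q : \int[nu]_s entropy_integrand q s =
    b%:E * (\int[nu]_s entropy_integrand r s - KL nu r q) +
    (1 - b)%:E * (\int[nu]_s entropy_integrand m s - KL nu m q).
  rewrite -!integralB// -!integralZl//; try exact: integrableB.
  rewrite -integralD//; try by apply: integrableZl => //; exact: integrableB.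
  apply: eq_integral => s _.
  rewrite (KL_integrand_dominated _ _ _ nu _ _ _ b0 brq pr).
  rewrite (KL_integrand_dominated _ _ _ nu _ _ _ c0 cmq pm).
  rewrite /entropy_integrand /= -!(EFinN, EFinD, EFinM).
  (* Only the factor [q s] outside the logarithm is expanded; [ln (q s)] stays an atom, and the
     terms [r ln r] and [m ln m] cancel. *)
  by congr EFin; rewrite {1}/q; ring.
rewrite /entropy split_q; move: gibbs.
have /fineK <- := integrable_fin_num measurableT hr.
have /fineK <- := integrable_fin_num measurableT hm.
have /fineK <- : KL nu r q \is a fin_num by exact: integrable_fin_num.
have /fineK <- : KL nu m q \is a fin_num by exact: integrable_fin_num.
rewrite -!(EFinN, EFinD, EFinM) !lee_fin => gibbs.
(* With all four integrals real, the two sides differ by exactly [(1 - b)] times the divergence of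
   [m] from [q]. *)
have := mulr_ge0 (ltW c0) gibbs; lra.
Qed.

Lemma mixture_density (R : realType) (d : measure_display)
    (S : measurableType d) (nu : {measure set S -> \bar R}) (b : R)
    (rho : nat -> S -> R) (mu0 : S -> R) (n : nat) : (0 <= b <= 1)%R ->
  (forall k, (1 <= k)%N -> is_prob_density nu (rho k)) ->
  is_prob_density nu mu0 -> is_prob_density nu (mixture b rho mu0 n).
Proof.
by move=> b01 prho pmu0; elim: n => //= n IH; apply: prob_density_mix => //;
  exact: prho.
Qed.

Theorem theorem1 (R : realType) (dS dA : measure_display)
    (S : measurableType dS) (A : measurableType dA)
    (nu : {measure set S -> \bar R})
    (P : R.-pker (S * A) ~> S) (delta0 : probability S R)
    (T : nat) (T_ge1 : (1 <= T)%N)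
    (pi : nat -> R.-pker S ~> A)
    (rho : nat -> S -> R)
    (rho_density : forall k, (1 <= k)%N -> is_prob_density nu (rho k))
    (rho_occupancy : forall k, (1 <= k)%N ->
       is_density_of nu (occupancy P (pi k) delta0 T) (rho k))
    (mu0 : S -> R) (mu0_density : is_prob_density nu mu0)
    (beta : R) (beta_gt0 : (0 < beta)%R) (beta_lt1 : (beta < 1)%R)
    (n : nat) :
  let mu := mixture beta rho mu0 in
  let H := fun k => entropy nu (mu k) in
  let Delta := H n.+1 - H n in
  finite_entropy nu (mu n) ->
  finite_entropy nu (mu n.+1) ->
  finite_entropy nu (rho n.+1) ->
  beta%:E * (KL nu (rho n.+1) (mu n.+1) + entropy nu (rho n.+1) - H n)
    <= Delta.
Proof.
(* [mu n.+1] is by computation the mixture of [r := rho n.+1] and [m := mu n]. *)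
move=> mu H Delta hm hq hr; apply: entropy_mix_ge => //; first exact: rho_density.
by apply: mixture_density => //; rewrite !ltW.
Qed.
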